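(* Let $(S,\cdot)$ be an infinite commutative discrete semigroup with identity $e$ which is action-free, i.e. $G_1(S)=\{e\}$. For each $n\in E_0(S)$ let $q_n=\sum_{j\in Q_n}q_n(j)\delta_j$ be a probability measure on $S$ with finite support $Q_n$ containing $e$ (so $q_n(j)>0$ for $j\in Q_n$). Define $*$ by $\delta_m*\delta_n=\delta_n*\delta_m=\delta_{mn}$ for $(m,n)\in (S\times S)\setminus\{(k,k):k\in E_0(S)\}$ and $\delta_n*\delta_n=q_n$ for $n\in E_0(S)$. Suppose the following conditions hold: (i) $E(S)$ is finite, or $E(S)$ (with the order $m<n$ iff $mn=n\neq m$) is isomorphic to $(\mathbb{Z}_+,<,\max)$; (ii) $\widetilde{S}=S\setminus E(S)$ is an ideal of $(S,\cdot)$; (iii) $Q_n\subset E(S)$ for $n\in E_0(S)$; (iv) if $n\in E_0(S)$ and $m\in\widetilde{S}$, then $Q_n\cdot m=\{nm\}$; (v) for $n\in E_0(S)$, $\mathcal{L}_n\subset Q_n\subset \mathcal{L}_n\cup\{n\}$, where $\mathcal{L}_n=\{j\in E(S): j<n\}$; (vi) if $\#E(S)>2$, then for $e\neq m<n$ in $E(S)$: $q_n(e)=q_n(m)q_m(e)$ and $q_n(e)\bigl(1+\sum_{e\neq k\in\mathcal{L}_n}\frac{1}{q_k(e)}\bigr)\le 1$. Then the (commutative discrete) semiconvo $(S,* )$ is a Ramsey semiconvo.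
   Context: For a semigroup $S$ with identity $e$: $E(S)=\{n\in S:n^2=n\}$, $E_0(S)=E(S)\setminus\{e\}$, $\widetilde S=S\setminus E(S)$; a nonempty $T\subset S$ is an ideal if $TS\subset T$ and $ST\subset T$; $G(S)=\{g\in S:\exists h,\ gh=hg=e\}$ and $G_1(S)=\{g\in G(S): gm=m \text{ for all } m\in E_0(S)\}$. Under conditions (i)–(vi), $(S,* )$ is a commutative discrete semiconvo (with $*$ extended bilinearly to measures). A discrete semiconvo is a set $K$ (discrete topology) with a map assigning to $m,n\in K$ a finitely supported probability measure $\delta_m*\delta_n$ on $K$, extended bilinearly to measures, which is associative ($(\delta_m*\delta_n)*\delta_k=\delta_m*(\delta_n*\delta_k)$) and has an identity $e$ ($\delta_m*\delta_e=\delta_e*\delta_m=\delta_m$). For an injective sequence $\langle x_n\rangle$ in $K\setminus\{e\}$ with range $B$ and a nonempty finite $F=\{x_{n_1},\dots,x_{n_m}\}\subset B$ with $n_1<\dots<n_m$, put $\delta_F=\delta_{x_{n_1}}*\cdots*\delta_{x_{n_m}}$. An infinite discrete semiconvo $K$ is a Ramsey semiconvo if for every finite partition $K=\bigcup_{i=1}^r C_i$ there exist $i$ and an injective sequence $\langle x_n\rangle$ in $K\setminus\{e\}$ with range $B$ such that $\operatorname{spt}(\delta_F)\subset C_i$ for every nonempty finite $F\subset B$.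
   Formalization: That (S,* ) is a semiconvo fails for finite E(S) with incomparable idempotents, so it (hence being a Ramsey semiconvo) is claimed only when E(S) is totally ordered; commutativity and the Ramsey partition property are claimed in all cases. *)

(* Defs.v *)
From HB Require Import structures.
From mathcomp Require Import all_boot all_order all_algebra finmap.
From mathcomp Require Import boolp classical_sets functions cardinality fsbigop.
From mathcomp Require Import reals.
From mathcomp Require Export monalg.

Set Implicit Arguments.
Unset Strict Implicit.
Unset Printing Implicit Defensive.

Import Order.TTheory GRing.Theory Num.Theory.

Local Open Scope classical_set_scope.
Local Open Scope ring_scope.

(* Finitely supported measures on a discrete set K are elements of the free
   R-module {malg R[K]}: << k >> is the point mass at k, mu@_k the mass of k
   and msupp mu the support of mu. *)

Section Semiconvo.
Context {R : realType} {K : choiceType}.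
Implicit Types (mu nu : {malg R[K]}) (star : K -> K -> {malg R[K]}).

Definition spt mu : set K := [set` msupp mu].

Definition probability_measure mu : Prop :=
  (forall k, 0 <= mu@_k) /\ \sum_(k <- msupp mu) mu@_k = 1.

(* The bilinear extension to measures of the convolution of point masses,
   star m n being the measure written delta_m * delta_n. *)
Definition conv star mu nu : {malg R[K]} :=
  \sum_(m <- msupp mu) \sum_(n <- msupp nu) (mu@_m * nu@_n) *: star m n.

Record discrete_semiconvo (e : K) star : Prop := DiscreteSemiconvo {
  semiconvo_prob : forall m n, probability_measure (star m n);
  semiconvo_assoc : forall m n k,
    conv star (star m n) << k >> = conv star << m >> (star n k);
  semiconvo_ident : forall m, star m e = << m >> /\ star e m = << m >>
}.

(* delta_F for F = {x_i | i in s}, where s lists the indices in increasing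
   order; products are bracketed to the left, and the empty product, never
   used below, is given the value delta_e. *)
Definition delta_fin (e : K) star (x : nat -> K) (s : seq nat) : {malg R[K]} :=
  if s is i :: s' then foldl (fun mu j => conv star mu << x j >>) << x i >> s'
  else << e >>.

(* As x is injective, the nonempty finite subsets of its range correspond to
   the nonempty strictly increasing finite sequences of indices. *)
Definition ramsey_property (e : K) star : Prop :=
  forall (r : nat) (C : 'I_r -> set K), partition [set: 'I_r] C [set: K] ->
  exists (i : 'I_r) (x : nat -> K),
    [/\ injective x, forall n, x n != e &
        forall s : seq nat, s != [::] -> sorted ltn s ->
          spt (delta_fin e star x s) `<=` C i].

Record ramsey_semiconvo (e : K) star : Prop := RamseySemiconvo {
  ramsey_infinite : infinite_set [set: K];
  ramsey_is_semiconvo : discrete_semiconvo e star;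
  ramsey_partition : ramsey_property e star
}.

End Semiconvo.

Section Semigroup.
Variable S : monoidType.
Local Open Scope group_scope.

Definition idempotents : set S := [set n | n * n = n].
Definition idempotents0 : set S := idempotents `\ 1.
Definition nonidempotents : set S := ~` idempotents.

Definition semigroup_ideal (T : set S) : Prop :=
  T !=set0 /\ forall t s, T t -> T (t * s) /\ T (s * t).

Definition invertibles : set S := [set g | exists h, g * h = 1 /\ h * g = 1].

Definition trivially_acting : set S :=
  [set g | invertibles g /\ forall m, idempotents0 m -> g * m = m].

Definition action_free : Prop := trivially_acting = [set 1].

(* Beware that this order is the opposite of the usual order of a
   semilattice: the identity is its least element. *)
Definition idem_lt (m n : S) : Prop := m * n = n /\ n <> m.

Definition idem_below (n : S) : set S := [set j | idempotents j /\ idem_lt j n].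

Definition idem_total : Prop :=
  forall m n, idempotents m -> idempotents n ->
    [\/ idem_lt m n, m = n | idem_lt n m].

Definition idem_iso_nat : Prop :=
  exists f : nat -> S,
    [/\ set_bij [set: nat] idempotents f,
        forall i j, (i < j)%N <-> idem_lt (f i) (f j) &
        forall i j, f (maxn i j) = f i * f j].

End Semigroup.

Arguments idempotents S : clear implicits.
Arguments idempotents0 S : clear implicits.
Arguments nonidempotents S : clear implicits.

Definition idem_deform (R : realType) (S : monoidType) (q : S -> {malg R[S]})
    (m n : S) : {malg R[S]} :=
  if (m == n) && (m \in idempotents0 S) then q m else << (m * n)%g >>.

(* Main.v *)
(* Ramsey property: the powers of an m in the ideal of non-idempotents are
   pairwise distinct, as otherwise one of them would be idempotent; they never
   meet a modified square, so convolution agrees with the product on them.  An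
   idempotent ultrafilter containing all tails of the powers of m then yields,
   as in the Galvin-Glazer proof of Hindman's theorem, the required sequence.

   Associativity: by commutativity it is the invariance of (m * n) * k under
   exchanging m and k, and the only case with content is q_n * delta_k = q_n
   for idempotents e < k < n.  This follows from q_n(j) = q_n(k) q_k(j) for
   j < k, a consequence of (vi), and from q_k having mass 1. *)

Require Import Defs.
From HB Require Import structures.
From mathcomp Require Import all_boot all_order all_algebra finmap.
From mathcomp Require Import boolp classical_sets functions cardinality fsbigop.
From mathcomp Require Import reals filter.
From mathcomp Require Import zify.

Set Implicit Arguments.
Unset Strict Implicit.
Unset Printing Implicit Defensive.

Import Order.TTheory GRing.Theory Num.Theory.

Local Open Scope classical_set_scope.
Local Open Scope card_scope.
Local Open Scope ring_scope.

(** * Idempotent ultrafilters and the Galvin-Glazer construction *)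

Section Hindman.
Context {T : Type} (op : T -> T -> T) (opA : associative op).
Implicit Types (F G H : set_system T) (A B : set T).

(** On ultrafilters this is the multiplication of the Stone-Cech compactification that extends
    [op]. *)
Definition filter_mul F G : set_system T :=
  [set A | F [set a | G [set b | A (op a b)]]].

Lemma filter_mulS F F' G G' {FF' : Filter F'} : F `<=` F' -> G `<=` G' ->
  filter_mul F G `<=` filter_mul F' G'.
Proof.
move=> sF sG A /sF; rewrite /filter_mul /=; apply: filterS => a; exact: sG.
Qed.

Lemma filter_mulA F G H :
  filter_mul F (filter_mul G H) = filter_mul (filter_mul F G) H.
Proof.
apply/funext => A; congr F; apply/funext => a; congr G; apply/funext => b.
by congr H; apply/funext => c; rewrite /= opA.
Qed.

Lemma filter_mul_proper F G {FF : ProperFilter F} {FG : ProperFilter G} :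
  ProperFilter (filter_mul F G).
Proof.
apply: Build_ProperFilter_ex => [A FA|].
  have /filter_ex [a /filter_ex [b Ab]] :
    F [set a | G [set b | A (op a b)]] by [].
  by exists (op a b).
split=> [|A B|A B sAB]; rewrite /filter_mul /=.
- by apply: filterE => a; apply: filterE.
- by apply: filterS2 => a; apply: filterS2.
- by apply: filterS => a; apply: filterS => b; apply: sAB.
Qed.

(** For an ultrafilter the inclusion is an equality, the product being a proper filter. *)
Definition sub_idempotent F := [/\ ProperFilter F & F `<=` filter_mul F F].

Lemma ex_maximal_sub_idempotent F0 : sub_idempotent F0 ->
  exists F, [/\ sub_idempotent F, F0 `<=` F &
    forall G, sub_idempotent G -> F `<=` G -> G = F].
Proof.
move=> idF0.
pose P F := F = set0 \/ sub_idempotent F /\ F0 `<=` F.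
have [|F [PF maxF]] := @Zorn_bigcup _ P.
  move=> Fs PFs totFs.
  have [[F FsF F0F]|noF] := pselect (exists2 F, Fs F & F !=set0); last first.
    left; rewrite -subset0 => A [F FsF FA]; apply: noF.
    by exists F => //; exists A.
  have good G A : Fs G -> G A -> sub_idempotent G /\ F0 `<=` G.
    by move=> FsG GA; have [G0|//] := PFs _ FsG; rewrite G0 in GA.
  have [B FB] := F0F; have [[FF idF] sF] := good _ _ FsF FB.
  right; split; first last.
    by move=> A /sF FA; exists F.
  have sub G : Fs G -> G `<=` \bigcup_(X in Fs) X by move=> FsG A GA; exists G.
  have FU : ProperFilter (\bigcup_(X in Fs) X).
    apply: Build_ProperFilter_ex => [A [G FsG GA]|].
      by have [[? _] _] := good _ _ FsG GA; apply: filter_ex GA.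
    split=> [|A1 A2 [G1 FsG1 GA1] [G2 FsG2 GA2]|A1 A2 sA [G FsG GA1]].
    - by exists F => //; apply: filterT.
    - have [[? _] _] := good _ _ FsG1 GA1; have [[? _] _] := good _ _ FsG2 GA2.
      have [s12|s21] := totFs _ _ FsG1 FsG2.
        by exists G2 => //; apply: filterI => //; apply: s12.
      by exists G1 => //; apply: filterI => //; apply: s21.
    - have [[? _] _] := good _ _ FsG GA1.
      by exists G => //; apply: filterS GA1.
  split=> // A [G FsG GA]; have [[_ idG] _] := good _ _ FsG GA.
  by apply: (@filter_mulS G _ G) (idG _ GA); apply: sub.
have PF0 : P F0 by right; split.
have [F_0|[idF sF]] := PF.
  exfalso; apply: maxF PF0; rewrite F_0; split=> [//|/(_ setT)].
  by case: idF0 => FF0 _; apply; apply: filterT.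
exists F; split=> // G idG sFG; apply: contrapT => neq.
apply: (maxF G); first by split=> // sGF; apply: neq; rewrite eqEsubset.
by right; split=> //; apply: subset_trans sFG.
Qed.

(* Ellis' theorem in the language of filters: a filter F stands for the closed
   set of the ultrafilters containing it, and F is contained in F * F exactly
   when that set is a subsemigroup.  Enlarging F to F * F, to F * p, and to the
   filter of { q in F | q * p = p } keeps this property. *)
Lemma ex_idempotent_ultrafilter F0 : sub_idempotent F0 ->
  exists p, [/\ UltraFilter p, F0 `<=` p & p `<=` filter_mul p p].
Proof.
move=> /ex_maximal_sub_idempotent[F [[FF idF] sF maxF]].
have [p [up sFp]] := ultraFilterLemma FF.
have FFp : F `<=` filter_mul F p.
  by apply: subset_trans idF _; exact: filter_mulS.
have pFp : ProperFilter (filter_mul F p) by exact: filter_mul_proper.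
have Fp : filter_mul F p = F.
  apply: maxF (FFp); split=> //; rewrite filter_mulA.
  have pFpF : ProperFilter (filter_mul (filter_mul F p) F).
    exact: filter_mul_proper.
  apply: filter_mulS => //; exact: subset_trans idF (filter_mulS FFp _).
pose st A := [set a | p [set b | A (op a b)]].
(* An ultrafilter q satisfies q * p = p exactly when it contains [st C] for every [C] in [p]. *)
pose H := [set A | exists B C, [/\ F B, p C & B `&` st C `<=` A]].
have FH : F `<=` H.
  by move=> B FB; exists B, setT; split; [|apply: filterT|apply: subIsetl].
have pH C : p C -> H (st C).
  by move=> pC; exists setT, C; split; [apply: filterT| |apply: subIsetr].
have pfH : ProperFilter H.
  apply: Build_ProperFilter_ex => [A [B [C [FB pC sA]]]|].
    suff [a Ba] : (B `&` st C) !=set0 by exists a; apply: sA.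
    apply: contrapT => /set0P/negP/negPn/eqP BC0.
    (* As [p] is ultra, a^-1 (~[C) lies in]p[for every a in]B[; so ~] C is in F * p = F, hence in
       [p]. *)
    have : filter_mul F p (~` C).
      apply: filterS FB => a Ba; rewrite /st /=.
      have [|//] := in_ultra_setVsetC [set b | C (op a b)] up.
      by move=> pa; suff : (set0 : set T) a by []; rewrite -BC0; split.
    rewrite Fp => /sFp pC'.
    by have [a []] := filter_ex (filterI pC pC').
  split=> [|A1 A2 [B1 [C1 [FB1 pC1 s1]]] [B2 [C2 [FB2 pC2 s2]]]|A1 A2 sA].
  - by apply: FH; apply: filterT.
  - exists (B1 `&` B2), (C1 `&` C2); split; [exact: filterI|exact: filterI|].
    move=> a [[B1a B2a] sta]; split.
      by apply: s1; split=> //; apply: filterS sta => b [].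
    by apply: s2; split=> //; apply: filterS sta => b [].
  - move=> [B [C [FB pC s]]]; exists B, C; split=> //.
    exact: subset_trans sA.
have HF : H = F.
  apply: maxF (FH); split=> // A [B [C [FB pC sA]]].
  have HB : filter_mul H H B by exact: (filter_mulS FH FH) (idF _ FB).
  (* For a in [st C], the set a^-1 C lies in [p], and its image under [st] is a^-1 (st C) by
     associativity. *)
  have HC : filter_mul H H (st C).
    apply: filterS (pH _ pC) => a /pH; rewrite /st /=.
    suff -> : [set b | p [set c | C (op (op a b) c)]] =
              st [set b | C (op a b)] by [].
    by apply/funext => b; congr p; apply/funext => c; rewrite /= opA.
  have pHH : ProperFilter (filter_mul H H) by exact: filter_mul_proper.
  exact: filterS sA (filterI HB HC).
exists p; split=> //; first exact: subset_trans sFp.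
by move=> A pA; apply: sFp; rewrite -HF; apply: pH.
Qed.

Lemma foldl_assoc (x : nat -> T) a b s :
  foldl (fun c j => op c (x j)) (op a b) s =
  op a (foldl (fun c j => op c (x j)) b s).
Proof. by elim: s b => //= i s IH b; rewrite -IH opA. Qed.

(* Galvin and Glazer: once x_0 is chosen in A with x_0^-1 A in p, the later
   terms are chosen so that all their products lie in A and x_0^-1 A. *)
Lemma idempotent_ultrafilter_products p A :
    UltraFilter p -> p `<=` filter_mul p p -> (forall a, p (~` [set a])) ->
    p A ->
  exists x : nat -> T, injective x /\
    forall i s, sorted ltn (i :: s) ->
      A (foldl (fun a j => op a (x j)) (x i) s).
Proof.
move=> up idp frp pA.
have /choice[f fP] B : exists a, p B -> B a /\ p [set b | B (op a b)].
  have [pB|npB] := pselect (p B); last by have [a _] := filter_ex pA; exists a.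
  by have [a ?] := filter_ex (filterI pB (idp _ pB)); exists a.
(* The second set keeps [f B] times any later product in [B]; the third makes the sequence
   injective. *)
pose next B := B `&` [set b | B (op (f B) b)] `&` ~` [set f B].
pose D n := iter n next A; pose x n := f (D n).
have pD n : p (D n).
  elim: n => //= n pDn; apply: filterI => //; apply: filterI => //.
  by have [] := fP _ pDn.
have sD i j : (i <= j)%N -> D j `<=` D i.
  move=> /subnKC <-; elim: (j - i)%N => [|k IH]; first by rewrite addn0.
  by rewrite addnS /= => b [[/IH]].
have Dx n : D n (x n) by have [] := fP _ (pD n).
exists x; split.
  suff ltx i j : (i < j)%N -> x i <> x j.
    by move=> i j xij; case: (ltngtP i j) => // /ltx; rewrite xij.
  by move=> /sD /(_ _ (Dx j)) [_ xji] /esym.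
(* Membership in [D i] is what allows induction: a product starting at j > i lies in [D i.+1], so
   x_i times it lies in [D i]. *)
move=> i s; suff: sorted ltn (i :: s) ->
  D i (foldl (fun a j => op a (x j)) (x i) s) by move=> h /h; apply: (sD 0%N).
elim: s i => [|j s IH] i /=; first by move=> _; apply: Dx.
move=> /andP[ij /IH]; rewrite foldl_assoc => /(sD _ _ ij).
by rewrite /= => -[[]].
Qed.

End Hindman.

(** * Convolution with point masses *)

Section Convolution.
Context {R : realType} {K : choiceType} (star : K -> K -> {malg R[K]}).
Implicit Types (mu nu : {malg R[K]}).

Lemma msupp_dirac (k : K) : msupp (<< k >> : {malg R[K]}) = [fset k]%fset.
Proof. by rewrite msuppU oner_eq0. Qed.

Lemma spt_dirac (k : K) : spt (<< k >> : {malg R[K]}) = [set k].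
Proof. rewrite /spt msupp_dirac.
by apply/seteqP; split=> j /=; rewrite in_fset1 => /eqP. Qed.

Lemma probability_dirac (k : K) : probability_measure (<< k >> : {malg R[K]}).
Proof.
split=> [j|]; first by rewrite mcoeffU mulrn_wge0.
by rewrite msupp_dirac big_seq_fset1 mcoeffUU.
Qed.

Lemma malg_sum_dirac mu : mu = \sum_(k <- msupp mu) mu@_k *: << k >>.
Proof.
rewrite {1}[mu]monalgE; apply: eq_bigr => k _.
by apply/malgP => j; rewrite mcoeffZ !mcoeffU mulr_natr.
Qed.

Lemma conv_diracr mu (k : K) :
  conv star mu << k >> = \sum_(j <- msupp mu) mu@_j *: star j k.
Proof.
apply: eq_bigr => j _.
by rewrite msupp_dirac big_seq_fset1 mcoeffUU mulr1.
Qed.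

Lemma conv_dirac (j k : K) : conv star << j >> << k >> = star j k.
Proof. by rewrite conv_diracr msupp_dirac big_seq_fset1 mcoeffUU scale1r. Qed.

Lemma conv_diracr_cst mu nu (k : K) : probability_measure mu ->
  {in msupp mu, forall j, star j k = nu} -> conv star mu << k >> = nu.
Proof.
move=> [_ mu1] munu; rewrite conv_diracr.
under eq_big_seq => j /munu -> do [].
by rewrite -scaler_suml mu1 scale1r.
Qed.

Lemma convC mu nu : commutative star -> conv star mu nu = conv star nu mu.
Proof.
move=> starC; rewrite /conv exchange_big; apply: eq_bigr => n _.
by apply: eq_bigr => m _; rewrite mulrC starC.
Qed.

(** Closure of [B] under [op] keeps every partial product a point mass; [B] will be the set of
    non-idempotents. *)
Lemma delta_fin_dirac (op : K -> K -> K) (B : set K) (e : K)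
    (x : nat -> K) i s :
    (forall a b, B a -> B b -> B (op a b) /\ star a b = << op a b >>) ->
    (forall n, B (x n)) ->
  delta_fin e star x (i :: s) = << foldl (fun a j => op a (x j)) (x i) s >>.
Proof.
move=> opB Bx; rewrite /=; have := Bx i.
elim: s (x i) => //= j s IH a Ba.
have [Bax axE] := opB _ _ Ba (Bx j).
by rewrite conv_dirac axE IH.
Qed.

End Convolution.

(** * Powers and the order of idempotents in a monoid *)

Section SemigroupPowers.
Context {S : monoidType}.
Local Open Scope group_scope.

(** Two equal powers make the sequence of powers eventually periodic, and then some power is
    idempotent. *)
Lemma expgn_nonidempotent_inj (m : S) :
    (forall k, nonidempotents S (m ^+ k.+1)) ->
  injective (fun k => m ^+ k.+1).
Proof.
move=> nonid.
suff lt_neq i j : (i < j)%N -> m ^+ i.+1 <> m ^+ j.+1.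
  by move=> i j mij; case: (ltngtP i j) => // /lt_neq; rewrite mij.
move=> ltij mij; pose d := (j - i)%N.
have per c t : m ^+ (i.+1 + c) = m ^+ (i.+1 + c + t * d)%N.
  elim: t => [|t IH]; first by rewrite addn0.
  rewrite IH mulSn -addnA expgnDr mij -expgnDr; congr (m ^+ _).
  by rewrite /d; lia.
have d0 : (0 < d)%N by rewrite subn_gt0.
(* This exponent is a multiple of the period [d] and at least [i.+1], where periodicity starts, so
   doubling it does not change the power. *)
apply: (nonid (i.+1 * d).-1); rewrite /idempotents /= prednK ?muln_gt0//.
rewrite -expgnDr; have := per (i.+1 * d - i.+1)%N i.+1.
by rewrite subnKC ?leq_pmulr// => <-.
Qed.

Lemma idem_lt_trans (j k n : S) : (forall x y : S, x * y = y * x) ->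
  idem_lt j k -> idem_lt k n -> idem_lt j n.
Proof.
move=> S_comm [jk kj] [kn nk]; split; first by rewrite -kn mulgA jk.
by move=> nj; apply: kj; rewrite -jk S_comm -nj kn.
Qed.

End SemigroupPowers.

Lemma ex_mem_ultrafilter (T : Type) (I : finType) (C : I -> set T)
    (p : set_system T) : UltraFilter p -> cover [set: I] C = setT ->
  exists i, p (C i).
Proof.
move=> up Ccov; apply: contrapT => nC.
have pC i : p (~` C i).
  by have [pCi|//] := in_ultra_setVsetC (C i) up; case: nC; exists i.
have [t nCt] := filter_ex (filter_forall _ pC).
have : cover [set: I] C t by rewrite Ccov.
by case=> i _; apply: nCt.
Qed.

(** * The deformed product and its Ramsey property *)

Section IdempotentDeformation.
Context {R : realType} {S : monoidType} (q : S -> {malg R[S]}).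
Hypothesis S_comm : forall x y : S, (x * y = y * x)%g.
Hypothesis nonid_ideal : semigroup_ideal (nonidempotents S).

Let star := idem_deform q.

Lemma idem_deformC : commutative star.
Proof.
by move=> m n; rewrite /star /idem_deform eq_sym S_comm; case: eqP => // ->.
Qed.

Lemma idem_deform_diag n : idempotents0 S n -> star n n = q n.
Proof. by move=> n0; rewrite /star /idem_deform eqxx mem_set. Qed.

Lemma idem_deform_dirac m n :
  ~ (m = n /\ idempotents0 S m) -> star m n = << (m * n)%g >>.
Proof.
move=> mn; rewrite /star /idem_deform; case: ifP => //.
move=> /andP[/eqP mnE /set_mem m0].
by case: mn.
Qed.

Lemma idem_deform1 m : star m 1%g = << m >>.
Proof.
by rewrite idem_deform_dirac ?mulg1// => -[-> [_]]; apply.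
Qed.

Lemma idem_deform_ramsey : ramsey_property 1%g star.
Proof.
move=> r C [Ccov _ _]; have [[m Nm] Nideal] := nonid_ideal.
have Npow k : nonidempotents S (m ^+ k.+1)%g.
  by elim: k => [|k IH]; rewrite ?expg1// expgS; apply: (Nideal _ _ _).1.
have pow_inj := expgn_nonidempotent_inj Npow.
pose F0 : set_system S :=
  filter_from [set: nat] (fun N =>
    [set (m ^+ k.+1)%g | k in [set k | (N <= k)%N]]).
have pF0 : ProperFilter F0.
  apply: filter_from_proper; last by move=> N _; exists (m ^+ N.+1)%g, N => /=.
  apply: filter_from_filter; first by exists 0%N.
  move=> M N _ _; exists (maxn M N) => // _ [k /= + <-]; rewrite geq_max.
  by move=> /andP[Mk Nk]; split; exists k.
have idF0 : sub_idempotent (fun x y : S => (x * y)%g) F0.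
  split=> // A [N _ sA]; exists N => // _ [j /= Nj <-].
  exists 0%N => // _ [k _ <-] /=.
  rewrite -expgnDr; apply: sA; exists (j + k.+1)%N => //=.
  exact: leq_trans Nj (leq_addr _ _).
have [p [up sF0 idp]] := ex_idempotent_ultrafilter (@mulgA S) idF0.
have [i pCi] := ex_mem_ultrafilter up Ccov.
have frp a : p (~` [set a]).
  have [[k ->]|nk] := pselect (exists k, a = (m ^+ k.+1)%g).
    apply: sF0; exists k.+1 => // _ [j /= kj <-] /pow_inj jk.
    by rewrite jk ltnn in kj.
  by apply: sF0; exists 0%N => // _ [j _ <-] /= ma; apply: nk; exists j.
have pN : p (nonidempotents S).
  by apply: sF0; exists 0%N => // _ [k _ <-]; apply: Npow.
(* Intersecting with the non-idempotents keeps the sequence away from e and in a set where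
   convolution is the product. *)
have [x [x_inj xP]] := idempotent_ultrafilter_products (@mulgA S) up idp frp
  (filterI pCi pN).
have Nx n : nonidempotents S (x n) by have [] := xP n [::] isT.
exists i, x; split=> // [n|[//|j s] _ js].
  apply/eqP => xn1; have := Nx n; rewrite xn1; apply.
  by rewrite /idempotents /= mulg1.
rewrite (delta_fin_dirac 1%g j s (op := fun a b => a * b)%g _ Nx).
  by rewrite spt_dirac => _ ->; have [] := xP j s js.
move=> a b Na Nb; split; first exact: (Nideal _ _ Na).1.
by rewrite idem_deform_dirac// => -[_ [/Na]].
Qed.

(** * Associativity of the deformed product *)

Hypothesis q_prob : forall n, idempotents0 S n -> probability_measure (q n).
Hypothesis q_one : forall n, idempotents0 S n -> spt (q n) 1%g.
Hypothesis q_idem : forall n, idempotents0 S n -> spt (q n) `<=` idempotents S.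
Hypothesis q_mul : forall n m, idempotents0 S n -> nonidempotents S m ->
  [set (j * m)%g | j in spt (q n)] = [set (n * m)%g].
Hypothesis q_spt : forall n, idempotents0 S n ->
  idem_below n `<=` spt (q n) /\ spt (q n) `<=` idem_below n `|` [set n].
Hypothesis q_mass : `I_3 #<= idempotents S -> forall m n, idempotents S m ->
  idempotents S n -> m <> 1%g -> idem_lt m n ->
  (q n)@_(1%g) = (q n)@_m * (q m)@_(1%g).

(* As e lies in Q_n, condition (iv) gives m = e m = n m. *)
Lemma idem_mul_nonid j m :
  idempotents S j -> nonidempotents S m -> (j * m)%g = m.
Proof.
move=> Ej Nm; have [->|/eqP j1] := eqVneq j 1%g; first by rewrite mul1g.
have j0 : idempotents0 S j by split.
have : [set (j * m)%g] (1 * m)%g.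
  by rewrite -q_mul//; exists 1%g => //; apply: q_one.
by rewrite mul1g /= => <-.
Qed.

Lemma q_one_neq0 n : idempotents0 S n -> (q n)@_(1%g) != 0.
Proof. by move=> n0; rewrite mcoeff_neq0; apply: q_one. Qed.

(** For j other than e, both sides times q_j(e), which is nonzero, equal q_n(e), by (vi) for the
    pairs j < n, j < k and k < n. *)
Lemma q_mass_trans j k n : idempotents S j -> idempotents0 S k ->
    idempotents0 S n -> idem_lt j k -> idem_lt k n ->
  (q n)@_j = (q n)@_k * (q k)@_j.
Proof.
move=> Ej [Ek k1] [En n1] jk kn.
have S3 : `I_3 #<= idempotents S.
  have /card_eq_fsetP : #|` [fset 1%g; k; n]%fset| = 3%N.
    have /eqP/negPf nk := kn.2; move/eqP/negPf in k1; move/eqP/negPf in n1.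
    rewrite fsetUC cardfsU1 cardfs2 !inE n1 nk eq_sym k1.
    by [].
  rewrite card_eq_le => /andP[_ /card_le_trans]; apply; apply: subset_card_le.
  by move=> x /=; rewrite !inE => /orP[/orP[]|] /eqP ->//; apply: mulg1.
have [->|/eqP j1] := eqVneq j 1%g; first exact: q_mass.
have jn := idem_lt_trans S_comm jk kn.
apply: (mulIf (q_one_neq0 (conj Ej j1))).
by rewrite -mulrA -!q_mass.
Qed.

Lemma idem_lt_dirac j k : idem_lt j k -> star j k = << k >>.
Proof. by move=> [jkE kj]; rewrite idem_deform_dirac ?jkE// => -[/esym]. Qed.

Lemma conv_q_above n k : idempotents0 S n -> idem_lt n k ->
  conv star (q n) << k >> = << k >>.
Proof.
move=> n0 nk; apply: conv_diracr_cst => [|j qj]; first exact: q_prob.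
apply: idem_lt_dirac; have [_ /(_ j qj) [[_ jn]|->//]] := q_spt n0.
exact: (idem_lt_trans S_comm jn nk).
Qed.

Hypothesis S_total : idem_total S.

(** Since j * k is k for j < k and j for j > k, the difference of the two sides is the sum over j <
    k of q_n(j) (delta_k - delta_j), plus q_n(k) (q_k - delta_k). Writing the last bracket as the
    sum of q_k(j) (delta_j - delta_k) makes the terms cancel one by one. *)
Lemma conv_q_below n k : idempotents0 S n -> idempotents0 S k -> idem_lt k n ->
  conv star (q n) << k >> = q n.
Proof.
move=> n0 k0 kn; rewrite conv_diracr [RHS]malg_sum_dirac.
have kQ : k \in msupp (q n).
  by have [+ _] := q_spt n0; apply; split=> //; case: k0.
have sQ : (msupp (q k) `<=` msupp (q n))%fset.
  apply/fsubsetP => j jQ; have [_ /(_ j jQ)] := q_spt k0.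
  case=> [[Ej jk]|->//]; have [+ _] := q_spt n0; apply.
  by split=> //; apply: idem_lt_trans jk kn.
have qkE : q k = \sum_(j <- msupp (q n)) (q k)@_j *: << j >>.
  rewrite [LHS]malg_sum_dirac; apply: big_fset_incl => // j _ /mcoeff_outdom ->.
  exact: scale0r.
have qk1 : \sum_(j <- msupp (q n)) (q k)@_j = 1.
  rewrite -(q_prob k0).2; apply/esym/big_fset_incl => // j _ /mcoeff_outdom ->.
  by [].
have qkB : q k - << k >> =
    \sum_(j <- msupp (q n) | j != k) (q k)@_j *: (<< j >> - << k >>).
  rewrite [in LHS]qkE -[X in _ - X]scale1r -qk1 scaler_suml -sumrB.
  rewrite (bigD1_seq k) ?fset_uniq//= subrr add0r.
  by apply: eq_bigr => j _; rewrite scalerBr.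
apply/eqP; rewrite -subr_eq0 -sumrB (bigD1_seq k) ?fset_uniq//=.
rewrite -scalerBr idem_deform_diag// qkB scaler_sumr -big_split /=.
rewrite big_seq_cond big1// => j /andP[jQ /eqP jk].
have Ej := q_idem n0 jQ.
rewrite scalerA -scalerBr; have [jltk|//|kltj] := S_total Ej k0.1.
  rewrite idem_lt_dirac// -(q_mass_trans Ej k0 n0 jltk kn) -scalerDr.
  by rewrite addrA subrK subrr scaler0.
rewrite idem_deformC idem_lt_dirac// subrr scaler0 addr0.
suff /mcoeff_outdom -> : j \notin msupp (q k) by rewrite mulr0 scale0r.
apply/negP => jQk.
have [_ /(_ j jQk) [[_ jltk]|//]] := q_spt k0.
by apply: kltj.2; rewrite -kltj.1 S_comm jltk.1.
Qed.

Lemma idem_mul_select m n :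
  idempotents S m -> idempotents S n -> (m * n)%g = m \/ (m * n)%g = n.
Proof.
move=> Em En; have [[-> _]|<-|[nm _]] := S_total Em En; first by right.
  by left.
by left; rewrite S_comm.
Qed.

Lemma idem_deform_probability m n : probability_measure (star m n).
Proof.
have [[<- m0]|/idem_deform_dirac ->] := pselect (m = n /\ idempotents0 S m).
  by rewrite idem_deform_diag//; apply: q_prob.
exact: probability_dirac.
Qed.

Lemma conv_star_nonid m n k :
    [\/ nonidempotents S m, nonidempotents S n | nonidempotents S k] ->
  conv star (star m n) << k >> = << (m * n * k)%g >>.
Proof.
move=> N; have [[mn m0]|mn] := pselect (m = n /\ idempotents0 S m).
  subst n; have Nk : nonidempotents S k by case: N => // -[]; case: m0.
  rewrite idem_deform_diag// -mulgA !(idem_mul_nonid m0.1)//.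
  apply: conv_diracr_cst => [|j jQ]; first exact: q_prob.
  have Ej := q_idem m0 jQ.
  rewrite idem_deform_dirac ?idem_mul_nonid// => -[jk _].
  by apply: Nk; rewrite -jk.
(* A modified square would need m * n = k idempotent, which the ideal of non-idempotents
   excludes. *)
rewrite idem_deform_dirac// conv_dirac idem_deform_dirac// => -[mnk [Emn _]].
case: N => [Nm|Nn|Nk].
- exact: (nonid_ideal.2 _ n Nm).1.
- exact: (nonid_ideal.2 _ m Nn).2.
- by apply: Nk; rewrite -mnk.
Qed.

Lemma conv_star_square m k : idempotents0 S m -> idempotents0 S k ->
  conv star (star m m) << k >> = conv star (star k m) << m >>.
Proof.
move=> m0 k0; rewrite idem_deform_diag//.
have [mk|->|km] := S_total m0.1 k0.1.
- rewrite conv_q_above// idem_deformC idem_lt_dirac// conv_dirac.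
  by rewrite idem_deformC idem_lt_dirac.
- by rewrite idem_deform_diag.
- by rewrite conv_q_below// idem_lt_dirac// conv_dirac idem_deform_diag.
Qed.

Lemma conv_star_rev m n k :
  conv star (star m n) << k >> = conv star (star k n) << m >>.
Proof.
have conv1 mu : conv star mu << 1%g >> = mu.
  rewrite conv_diracr [RHS]malg_sum_dirac.
  by apply: eq_bigr => j _; rewrite idem_deform1.
have [[Em En Ek]|N] := pselect
    [/\ idempotents S m, idempotents S n & idempotents S k]; last first.
  have N3 : [\/ nonidempotents S m, nonidempotents S n | nonidempotents S k].
    apply: contrapT => nN; apply: N.
    by split; apply: contrapT => ?; apply: nN;
      [apply: Or31|apply: Or32|apply: Or33].
  rewrite !conv_star_nonid//; last first.
    by case: N3; [apply: Or33|apply: Or32|apply: Or31].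
  by rewrite S_comm (S_comm m) mulgA.
have [->|/eqP m1] := eqVneq m 1%g.
  rewrite conv1 [star 1%g n]idem_deformC idem_deform1 conv_dirac.
  exact: idem_deformC.
have [->|/eqP k1] := eqVneq k 1%g.
  rewrite conv1 [star 1%g n]idem_deformC idem_deform1 conv_dirac.
  exact: idem_deformC.
have [->|/eqP n1] := eqVneq n 1%g.
  by rewrite !idem_deform1 !conv_dirac idem_deformC.
have [->//|/eqP mk] := eqVneq m k.
have [<-|/eqP mn] := eqVneq m n; first exact: conv_star_square.
have [<-|/eqP nk] := eqVneq n k; first by rewrite -conv_star_square.
(* By totality a product of two idempotents is one of them, so no modified square arises from three
   distinct ones. *)
have mnk : (m * n)%g <> k by case: (idem_mul_select Em En) => ->.
have knm : (k * n)%g <> m by case: (idem_mul_select Ek En) => -> // /esym.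
have dirac a b : a <> b -> star a b = << (a * b)%g >>.
  by move=> ab; rewrite idem_deform_dirac// => -[].
rewrite [star m n]dirac// [star k n]dirac; last by move/esym.
by rewrite !conv_dirac !dirac// S_comm (S_comm m) mulgA.
Qed.

Lemma idem_deform_semiconvo : discrete_semiconvo 1%g star.
Proof.
split=> [|m n k|m]; first exact: idem_deform_probability.
  by rewrite conv_star_rev convC ?[star k n]idem_deformC//; apply: idem_deformC.
by rewrite [star 1%g m]idem_deformC !idem_deform1.
Qed.

End IdempotentDeformation.

(** A finite E(S) may fail to be a chain. For incomparable m and n, q_m * delta_n charges n, while
    delta_m * (delta_m * delta_n) is the point mass at mn, which differs from n; hence the premise
    [idem_total S] of the last claim. *)
Theorem theorem3p4 (R : realType) (S : monoidType) (q : S -> {malg R[S]})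
    (S_comm : forall x y : S, (x * y = y * x)%g)
    (S_inf : infinite_set [set: S])
    (S_af : action_free S)
    (q_prob : forall n, idempotents0 S n -> probability_measure (q n))
    (q_one : forall n, idempotents0 S n -> spt (q n) 1%g)
    (cond_i : finite_set (idempotents S) \/ idem_iso_nat S)
    (cond_ii : semigroup_ideal (nonidempotents S))
    (cond_iii : forall n, idempotents0 S n -> spt (q n) `<=` idempotents S)
    (cond_iv : forall n m, idempotents0 S n -> nonidempotents S m ->
       [set (j * m)%g | j in spt (q n)] = [set (n * m)%g])
    (cond_v : forall n, idempotents0 S n ->
       idem_below n `<=` spt (q n) /\ spt (q n) `<=` idem_below n `|` [set n])
    (cond_vi : `I_3 #<= idempotents S ->
       forall m n, idempotents S m -> idempotents S n ->
       m <> 1%g -> idem_lt m n ->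
       (q n)@_(1%g) = (q n)@_m * (q m)@_(1%g) /\
       (q n)@_(1%g) *
         (1 + \sum_(k \in idem_below n `\ 1%g) ((q k)@_(1%g))^-1) <= 1) :
  [/\ commutative (idem_deform q),
      ramsey_property 1%g (idem_deform q)
    & idem_total S -> ramsey_semiconvo 1%g (idem_deform q)].
Proof.
have q_mass : `I_3 #<= idempotents S -> forall m n, idempotents S m ->
    idempotents S n -> m <> 1%g -> idem_lt m n ->
  (q n)@_(1%g) = (q n)@_m * (q m)@_(1%g).
  by move=> S3 m n Em En m1 mn; have [] := cond_vi S3 m n Em En m1 mn.
have ramsey := idem_deform_ramsey q cond_ii.
split; [exact: idem_deformC | exact: ramsey | move=> S_total].
split; [exact: S_inf | exact: idem_deform_semiconvo | exact: ramsey].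
Qed.
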